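(* Let $d\geq 2$ be an integer. Any finite graph $G=(V,E)$ with maximum degree $d-1$ has spherical dimension at most $d$.
   Context: All graphs are finite, simple and undirected. For an integer $k\ge 1$, $\mathbb{S}^{k-1}\subset\mathbb{R}^k$ denotes the sphere of radius $1/\sqrt{2}$ centred at the origin. A graph $G=(V,E)$ is realizable in a subset $X\subseteq\mathbb{R}^k$ if there is an injective map $\phi\colon V\to X$ such that $|\phi(x)-\phi(y)|=1$ (Euclidean distance) for every edge $xy\in E$; non-adjacent vertices may also be mapped to points at distance $1$. The spherical dimension $\dim_S G$ of $G$ is the smallest integer $k$ such that $G$ is realizable on $\mathbb{S}^{k-1}\subset\mathbb{R}^k$. *)

(* Defs.v *)
From HB Require Import structures.
From mathcomp Require Import all_boot all_order all_algebra.
From mathcomp Require Import boolp classical_sets reals.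

Set Implicit Arguments.
Unset Strict Implicit.
Unset Printing Implicit Defensive.

Import Order.TTheory GRing.Theory Num.Theory.

Local Open Scope ring_scope.

Record sgraph := SGraph {
  vertex :> finType;
  adj : rel vertex;
  adj_sym : symmetric adj;
  adj_irrefl : irreflexive adj }.

Definition degree (G : sgraph) (v : G) : nat := #|[set w | adj v w]|.

(* The value is 0 on the graph with no vertices. *)
Definition max_degree (G : sgraph) : nat := \max_(v : G) degree v.

(* The norm that MathComp-Analysis puts on 'rV[R]_k is the sup norm, hence this
   explicit Euclidean distance. *)
Definition edist (R : realType) (k : nat) (x y : 'rV[R]_k) : R :=
  Num.sqrt (\sum_(i < k) (x 0 i - y 0 i) ^+ 2).

(* S^(k-1), as a subset of R^k: the index is the dimension of the ambient space,
   and the radius is 1 / sqrt 2. *)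
Definition sphere (R : realType) (k : nat) : set 'rV[R]_k :=
  [set x | edist x 0 = 1 / Num.sqrt 2]%classic.

Definition realizable (R : realType) (k : nat) (X : set 'rV[R]_k)
    (G : sgraph) : Prop :=
  exists phi : G -> 'rV[R]_k,
    [/\ injective phi,
        forall v, X (phi v) &
        forall v w, adj v w -> edist (phi v) (phi w) = 1].

Lemma spherically_realizable (R : realType) (G : sgraph) :
  exists k, (0 < k)%N && `[< realizable (@sphere R k) G >].
Proof.
exists #|G|.+1; apply/asboolP.
pose c : R := (Num.sqrt 2)^-1.
have c2 : c ^+ 2 = 2^-1 by rewrite exprVn sqr_sqrtr.
have c0 : c != 0 by rewrite invr_eq0 sqrtr_eq0 -ltNge.
pose p (v : G) : 'I_(#|G|.+1) := lift ord0 (enum_rank v).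
have p_inj : injective p by move=> v w /lift_inj /enum_rank_inj.
exists (fun v => c *: delta_mx 0 (p v)); split.
- move=> v w /rowP /(_ (p v)); rewrite !mxE !eqxx /= mulr1.
  case: eqP => [/p_inj // | _] /eqP.
  by rewrite mulr0 (negbTE c0).
- move=> v; rewrite /sphere /edist /= (bigD1 (p v)) //= big1 => [|i /negbTE ne].
    rewrite !mxE !eqxx /= mulr1 subr0 addr0 sqrtr_sqr ger0_norm ?div1r //.
    by rewrite invr_ge0 sqrtr_ge0.
  by rewrite !mxE ne mulr0 subr0 expr0n.
- move=> v w vw.
  have pvw : p v != p w.
    by apply: contraTneq vw => /p_inj ->; rewrite adj_irrefl.
  rewrite /edist (bigD1 (p v)) //= (bigD1 (p w)) 1?eq_sym //= big1 => [|i].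
    rewrite !mxE !eqxx (negbTE pvw) eq_sym (negbTE pvw) /= mulr1 mulr0.
    rewrite subr0 sub0r sqrrN c2 addr0.
    have -> : 2^-1 + 2^-1 = 1 :> R by rewrite -div1r -splitr.
    exact: sqrtr1.
  case/andP=> /negbTE iv /negbTE iw.
  by rewrite !mxE iv iw !mulr0 subr0 expr0n.
Qed.

(* The least k >= 1 such that G is realizable on S^(k-1). *)
Definition spherical_dim (R : realType) (G : sgraph) : nat :=
  ex_minn (spherically_realizable R G).

(* Main.v *)
Require Import Defs.
From mathcomp Require Import all_boot all_order all_algebra.
From mathcomp Require Import reals.
From mathcomp Require Import boolp zify ring lra.

Set Implicit Arguments.
Unset Strict Implicit.
Unset Printing Implicit Defensive.

Import Order.TTheory GRing.Theory Num.Theory.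

(** Two points of the sphere of radius 1 / sqrt 2 are at distance 1 exactly when
they are orthogonal, so the graph needs distinct unit vectors of R^d, orthogonal
along the edges ([orthorep]).

Lovasz's partition argument ([deg_partition]) splits a vertex set of maximum
degree at most a + b + 1 into two parts of internal degrees at most a and b.
Representations of the two parts in complementary orthogonal subspaces combine
into one of the whole, because all edges between the parts are then respected
([orthorepD]).  Peeling off parts of internal degree at most 1, each placed in a
plane of its own, lowers d by 2 at a time and leaves the cases d = 2 and d = 3.

For d = 2 the graph is a matching: give each edge its own orthogonal frame of the
plane ([orthorep_matching]).

For d = 3 the maximum degree is 2.  The partition with (a, b) = (1, 0) gives a
matching B and an independent set I ([orthorep_space]).  The edges of B are sent
to pairs of orthogonal vectors that are otherwise in general position
([generic_pairs]).  A vertex of I has at most two neighbours in B, and is sent to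
the cross product of their vectors; missing neighbours are replaced by fresh
generic vectors.  By general position, two vertices are on the same line only if
they are in I and have the same two neighbours, and the degree bound allows at
most two vertices of I to share a neighbour.  Hence each line is used at most
twice, and choosing opposite unit vectors on it separates the two vertices
([orthorep_lines]).  Such coincidences cannot be avoided in general: in a 4-cycle
of R^3 at least one diagonal joins two vectors of the same line. *)

(** * Splitting a vertex set by internal degree *)

Section Partition.
Variables (T : finType) (e : rel T).
Hypotheses (e_sym : symmetric e) (e_irr : irreflexive e).

Definition deg_in (S : {set T}) (v : T) : nat := #|[set w in S | e v w]|.

Lemma deg_inE (S : {set T}) v : deg_in S v = \sum_(w in S) e v w.
Proof.
rewrite /deg_in -sum1dep_card big_mkcondr /=.
by apply: eq_bigr => w _; case: (e v w).
Qed.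

Lemma deg_inU1 (S : {set T}) u v : v \notin S -> deg_in (v |: S) u = e u v + deg_in S u.
Proof. by move=> vS; rewrite !deg_inE big_setU1. Qed.

Lemma deg_in_split (A B : {set T}) v :
  B \subset A -> deg_in A v = deg_in B v + deg_in (A :\: B) v.
Proof.
move=> sBA; rewrite !deg_inE (big_setID B) /=.
by rewrite (setIidPr sBA).
Qed.

Definition arcs (S : {set T}) : nat := \sum_(v in S) deg_in S v.

Lemma arcsU1 (S : {set T}) v : v \notin S -> arcs (v |: S) = arcs S + (deg_in S v).*2.
Proof.
move=> vS; rewrite /arcs big_setU1 //= deg_inU1 // e_irr add0n.
under eq_bigr => u _ do rewrite deg_inU1 //.
rewrite big_split /=.
have -> : \sum_(u in S) e u v = deg_in S v.
  by rewrite deg_inE; apply: eq_bigr => u _; rewrite e_sym.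
by rewrite -addnn; lia.
Qed.

(** Minimise the number of edges inside the two parts, corrected by the linear
terms that make the quantity drop whenever a vertex exceeding the bound of its
part changes sides. *)
Lemma deg_partition (A : {set T}) (a b : nat) :
  {in A, forall v, deg_in A v <= a + b + 1} ->
  exists B : {set T}, [/\ B \subset A,
    {in B, forall v, deg_in B v <= a} &
    {in A :\: B, forall v, deg_in (A :\: B) v <= b}].
Proof.
move=> degA.
(* Doubled edge counts, minus (2 a |B| + 2 b |C|), shifted by the constant
   2 (a + b) |A| to remain a natural number. *)
pose cost a' b' (B C : {set T}) := arcs B + (b' * #|B|).*2 + (arcs C + (a' * #|C|).*2).
have move_cost a' b' (B C : {set T}) v : v \in B -> v \notin C ->
    deg_in B v + deg_in C v <= a' + b' + 1 ->
    cost a' b' B C <= cost a' b' (B :\ v) (v |: C) -> deg_in B v <= a'.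
  move=> vB vC dv; rewrite /cost.
  have vB' : v \notin B :\ v by rewrite !inE eqxx.
  have eB : B = v |: (B :\ v) by rewrite setD1K.
  rewrite {1 2}eB arcsU1 // (arcsU1 vC) !cardsU1 vB' vC /= => le.
  have dB : deg_in B v = deg_in (B :\ v) v by rewrite {1}eB deg_inU1 // e_irr.
  rewrite dB in dv *; nia.
have [B sBA minB] := @arg_minnP _ set0 (fun B : {set T} => B \subset A)
   (fun B => cost a b B (A :\: B)) (sub0set A).
exists B; split=> // v vB.
  have vA : v \in A by apply: (subsetP sBA).
  apply: (move_cost a b B (A :\: B)) => //; first by rewrite !inE vB.
    by rewrite -deg_in_split ?degA.
  have -> : v |: A :\: B = A :\: (B :\ v).
    by apply/setP=> w; rewrite !inE; case: eqP => // ->; rewrite vA.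
  by apply: minB; apply: subset_trans sBA; apply: subsetDl.
move: (vB); rewrite !inE => /andP[vNB vA].
apply: (move_cost b a (A :\: B) B) => //.
  by rewrite addnC -deg_in_split // addnC (addnC b) addnC degA.
have -> : A :\: B :\ v = A :\: (v |: B).
  by apply/setP=> w; rewrite !inE negb_or andbA.
rewrite /cost addnC [leqRHS]addnC; apply: minB.
by rewrite subUset sub1set vA.
Qed.

(** Labels the vertices of a matching as ends of numbered edges: a vertex and its
mate get the same number, the smaller of their ranks, and different booleans. *)
Lemma matching_index (B : {set T}) : {in B, forall v, deg_in B v <= 1} ->
  exists f : T -> nat * bool, [/\ {in B &, injective f},
    forall v, (f v).1 < #|T| &
    {in B &, forall v w, e v w -> (f v).1 = (f w).1}].
Proof.
move=> degB.
have uniq_nbr u v w : u \in B -> v \in B -> w \in B -> e u v -> e u w -> v = w.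
  move=> uB vB wB uv uw; have /card_le1_eqP := degB u uB.
  by apply; rewrite inE ?vB ?wB.
pose mate v := odflt v [pick w in B | e v w].
have mateP v : mate v != v -> mate v \in B /\ e v (mate v).
  by rewrite /mate; case: pickP => [w /andP[]//|] /=; rewrite eqxx.
have mateE v w : v \in B -> w \in B -> e v w -> mate v = w.
  move=> vB wB vw; rewrite /mate; case: pickP => [x /andP[xB vx]|/(_ w)] /=.
    exact: (uniq_nbr v).
  by rewrite wB vw.
pose rk (v : T) : nat := enum_rank v.
have rk_inj : injective rk by move=> v w /val_inj /enum_rank_inj.
exists (fun v => (minn (rk v) (rk (mate v)), rk (mate v) < rk v)); split=> /=.
- move=> v w vB wB [].
  case: ltnP => lv; case: ltnP => lw //; last by move=> + _; exact: rk_inj.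
  move=> /rk_inj mvw _.
  have [mB vm] : mate v \in B /\ e v (mate v).
    by apply: mateP; apply: contraTneq lv => ->; rewrite ltnn.
  have [_ wm] : mate w \in B /\ e w (mate w).
    by apply: mateP; apply: contraTneq lw => ->; rewrite ltnn.
  by apply: (uniq_nbr (mate v)); rewrite // e_sym // mvw.
- by move=> v; apply: leq_ltn_trans (geq_minl _ _) (ltn_ord _).
- move=> v w vB wB vw; rewrite (mateE v w) // (mateE w v) //; last by rewrite e_sym.
  exact: minnC.
Qed.

End Partition.

(** * Orthogonal representations *)

Local Open Scope ring_scope.

Section Dot.
Variables (R : rcfType).

Definition dot k (x y : 'rV[R]_k) : R := \sum_i x 0 i * y 0 i.

Lemma dotC k (x y : 'rV[R]_k) : dot x y = dot y x.
Proof. by apply: eq_bigr => i _; rewrite mulrC. Qed.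

Lemma dotZl k c (x y : 'rV[R]_k) : dot (c *: x) y = c * dot x y.
Proof. by rewrite mulr_sumr; apply: eq_bigr => i _; rewrite mxE mulrA. Qed.

Lemma dotZr k c (x y : 'rV[R]_k) : dot x (c *: y) = c * dot x y.
Proof. by rewrite dotC dotZl dotC. Qed.

Lemma dot0l k (y : 'rV[R]_k) : dot 0 y = 0.
Proof. by rewrite -(scale0r 0) dotZl mul0r. Qed.

Lemma dot_ge0 k (x : 'rV[R]_k) : 0 <= dot x x.
Proof. by apply: sumr_ge0 => i _; rewrite -expr2 sqr_ge0. Qed.

Lemma dot_eq0 k (x : 'rV[R]_k) : (dot x x == 0) = (x == 0).
Proof.
apply/idP/eqP => [|->]; last by rewrite dot0l.
rewrite psumr_eq0 => [/allP h|i _]; last by rewrite -expr2 sqr_ge0.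
apply/rowP=> i; rewrite mxE; apply/eqP.
by have := h i (mem_index_enum i); rewrite mulf_eq0 orbb.
Qed.

Lemma dot_row_mx k l (x y : 'rV[R]_k) (x' y' : 'rV[R]_l) :
  dot (row_mx x x') (row_mx y y') = dot x y + dot x' y'.
Proof.
rewrite /dot big_split_ord /=; congr (_ + _); apply: eq_bigr => i _;
by rewrite ?row_mxEl ?row_mxEr.
Qed.

Definition normalize k (x : 'rV[R]_k) : 'rV[R]_k := (Num.sqrt (dot x x))^-1 *: x.

Lemma sqrt_dot_neq0 k (x : 'rV[R]_k) : x != 0 -> (Num.sqrt (dot x x))^-1 != 0.
Proof.
by rewrite -dot_eq0 invr_eq0 sqrtr_eq0 -ltNge lt_neqAle dot_ge0 eq_sym andbT.
Qed.

Lemma dot_normalize k (x : 'rV[R]_k) : x != 0 -> dot (normalize x) (normalize x) = 1.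
Proof.
move=> x0; rewrite dotZl dotZr mulrA -expr2 exprVn sqr_sqrtr ?dot_ge0 //.
by rewrite mulVf ?dot_eq0.
Qed.

Definition parallel k (x y : 'rV[R]_k) := exists c, x = c *: y.

End Dot.

Section Representation.
Variables (R : rcfType) (T : finType) (e : rel T).

Definition orthorep k (A : {set T}) := exists phi : T -> 'rV[R]_k,
  [/\ {in A &, injective phi}, {in A, forall v, dot (phi v) (phi v) = 1} &
      {in A &, forall v w, e v w -> dot (phi v) (phi w) = 0}].

(** Vectors of the two parts are orthogonal whether or not they need to be, so
only the edges inside each part matter; and they are distinct, being nonzero. *)
Lemma orthorepD k l (A B : {set T}) : B \subset A ->
  orthorep k B -> orthorep l (A :\: B) -> orthorep (k + l) A.
Proof.
move=> sBA [f [f_inj f1 f_orth]] [g [g_inj g1 g_orth]].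
have inC v : v \in A -> v \notin B -> v \in A :\: B by rewrite inE => -> ->.
pose h v := if v \in B then row_mx (f v) (0 : 'rV_l) else row_mx (0 : 'rV_k) (g v).
have f_neq0 v : v \in B -> f v <> 0.
  by move=> /f1 + fv0; rewrite fv0 dot0l => /eqP; rewrite eq_sym oner_eq0.
exists h; split.
- move=> v w vA wA; rewrite /h; case: ifPn => vB; case: ifPn => wB;
    move=> /eq_row_mx [] //.
  + by move=> + _; apply: f_inj.
  + by move=> /f_neq0.
  + by move=> /esym /f_neq0.
  + by move=> _; apply: g_inj; apply: inC.
- move=> v vA; rewrite /h; case: ifPn => vB; rewrite dot_row_mx dot0l.
    by rewrite addr0 f1.
  by rewrite add0r g1 ?inC.
- move=> v w vA wA vw; rewrite /h; case: ifPn => vB; case: ifPn => wB;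
    rewrite dot_row_mx.
  + by rewrite dot0l addr0 f_orth.
  + by rewrite dotC !dot0l addr0.
  + by rewrite dot0l dotC dot0l addr0.
  + by rewrite dot0l add0r g_orth ?inC.
Qed.

(** A line through the origin carries two opposite unit vectors, so it can serve
two vertices: of two vertices that normalise to the same vector, the later one in
the enumeration is given the opposite sign. *)
Lemma orthorep_lines k (A : {set T}) (Y : T -> 'rV[R]_k) :
    {in A, forall v, Y v != 0} ->
    {in A &, forall v w, e v w -> dot (Y v) (Y w) = 0} ->
    (forall u v w, u \in A -> v \in A -> w \in A -> u != v -> u != w -> v != w ->
       parallel (Y u) (Y v) -> parallel (Y u) (Y w) -> False) ->
  orthorep k A.
Proof.
move=> Y0 Yorth Y3.
pose psi v := normalize (Y v).
pose rk (v : T) : nat := enum_rank v.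
have rk_inj : injective rk by move=> v w /val_inj /enum_rank_inj.
pose flip v := [exists u in A, (rk u < rk v)%N && (psi u == psi v)].
pose sg v : R := (-1) ^+ flip v.
have psi_par v w : v \in A -> w \in A -> forall c, psi v = c *: psi w -> parallel (Y v) (Y w).
  move=> vA wA c; rewrite /psi /normalize.
  set a := (_)^-1; set b := (_)^-1 => E.
  exists (a^-1 * (c * b)); rewrite -!scalerA -E scalerA mulVf ?scale1r //.
  exact: sqrt_dot_neq0 (Y0 _ vA).
have flipP v : flip v -> exists u, [/\ u \in A, (rk u < rk v)%N & psi u = psi v].
  by case/existsP=> u /andP[uA /andP[lt /eqP E]]; exists u.
exists (fun v => sg v *: psi v); split.
- move=> v w vA wA.
  wlog lt_vw : v w vA wA / (rk v < rk w)%N.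
    case: (ltngtP (rk v) (rk w)) => [lt|lt|/rk_inj //] W E; first exact: W.
    by apply/esym/W.
  have vw : v != w by apply: contraTneq lt_vw => ->; rewrite ltnn.
  move=> E; exfalso.
  have {}E : psi v = (sg v * sg w) *: psi w.
    by rewrite -scalerA -E scalerA /sg -expr2 sqrr_sign scale1r.
  have par_vw := psi_par v w vA wA _ E.
  (* If v and w collide, then w was flipped because of some vertex other than v,
     or v itself was flipped: either way a third vertex is on the same line. *)
  have third u x : u \in A -> u != v -> u != w -> x \in A -> (x = v \/ x = w) ->
      psi u = psi x -> False.
    move=> uA uv uw xA [-> ux|-> ux].
      apply: (Y3 v u w) => //; first by rewrite eq_sym.
      by apply: (psi_par _ _ vA uA 1); rewrite scale1r.
    apply: (Y3 w u v) => //; first by rewrite eq_sym.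
    + by rewrite eq_sym.
    + by apply: (psi_par _ _ wA uA 1); rewrite scale1r.
    + apply: (psi_par _ _ wA vA (sg v * sg w)).
      by rewrite E scalerA /sg -expr2 exprMn !sqrr_sign mulr1 scale1r.
  have Nfv : ~~ flip v.
    apply/negP=> /flipP [u [uA lt ux]]; apply: (third u v) => //; last by left.
      by apply: contraTneq lt => ->; rewrite ltnn.
    by apply: contraTneq (ltn_trans lt lt_vw) => ->; rewrite ltnn.
  have [fw|Nfw] := boolP (flip w).
    have [u [uA lt ux]] := flipP _ fw.
    have [uv|uv] := eqVneq u v.
      subst u; move: E; rewrite /sg fw (negbTE Nfv) mul1r expr1 scaleN1r ux.
      move/eqP; rewrite -subr_eq0 opprK -mulr2n -scaler_nat scaler_eq0 pnatr_eq0 /=.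
      rewrite /psi /normalize scaler_eq0 (negbTE (Y0 _ wA)) orbF.
      by rewrite (negbTE (sqrt_dot_neq0 (Y0 _ wA))).
    apply: (third u w) => //; last by right.
    by apply: contraTneq lt => ->; rewrite ltnn.
  case/negP: (Nfw); apply/existsP; exists v; rewrite vA lt_vw /= E.
  by rewrite /sg (negbTE Nfv) (negbTE Nfw) mulr1 scale1r.
- move=> v vA; rewrite dotZl dotZr mulrA -expr2 sqrr_sign mul1r.
  by rewrite dot_normalize ?Y0.
- by move=> v w vA wA vw; rewrite !(dotZl, dotZr) (Yorth v w) // !mulr0.
Qed.

End Representation.

(** * Matchings in the plane *)

Section Plane.
Variables (R : rcfType).

Definition vec2 (a b : R) : 'rV[R]_2 := \row_(i < 2) nth 0 [:: a; b] i.

Lemma dot_vec2 a b a' b' : dot (vec2 a b) (vec2 a' b') = a * a' + b * b'.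
Proof. by rewrite /dot !big_ord_recl big_ord0 !mxE /= addr0. Qed.

Lemma parallel_vec2 a b a' b' :
  parallel (vec2 a b) (vec2 a' b') -> a * b' = b * a'.
Proof.
case=> c /rowP E.
have := E 0; have := E 1; rewrite !mxE /= => -> ->; ring.
Qed.

(** For each i, the orthogonal pair (1, i), (-i, 1): the slopes i and -1/i are
all different, which makes the vectors pairwise nonparallel. *)
Definition plane_frame (x : nat * bool) : 'rV[R]_2 :=
  if x.2 then vec2 (- x.1%:R) 1 else vec2 1 x.1%:R.

Lemma plane_frame_parallel x y :
  parallel (plane_frame x) (plane_frame y) -> x = y.
Proof.
case: x y => [i []] [j []]; rewrite /plane_frame /= => /parallel_vec2.
- by rewrite mulr1 mul1r => /oppr_inj /eqP; rewrite eqr_nat => /eqP ->.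
- by move=> E; exfalso; have := mulr_ge0 (ler0n R i) (ler0n R j); lra.
- by move=> E; exfalso; have := mulr_ge0 (ler0n R i) (ler0n R j); lra.
- by rewrite mulr1 mul1r => /eqP; rewrite eqr_nat => /eqP ->.
Qed.

Lemma pair_orth k (X : nat * bool -> 'rV[R]_k) x y :
  (forall i, dot (X (i, false)) (X (i, true)) = 0) ->
  x.1 = y.1 -> x != y -> dot (X x) (X y) = 0.
Proof.
case: x y => [i []] [j []] X0 /= <-; rewrite ?eqxx // => _.
by rewrite dotC.
Qed.

Lemma orthorep_matching (T : finType) (e : rel T) (A : {set T}) :
  symmetric e -> irreflexive e -> {in A, forall v, deg_in e A v <= 1}%N ->
  orthorep R e 2 A.
Proof.
move=> e_sym e_irr degA.
have [f [f_inj _ f_adj]] := matching_index e_sym degA.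
apply: (orthorep_lines (Y := plane_frame \o f)) => /=.
- move=> v _; apply/eqP=> Y0; pose y := ((f v).1, ~~ (f v).2).
  have /plane_frame_parallel : parallel (plane_frame (f v)) (plane_frame y).
    by exists 0; rewrite scale0r.
  by rewrite /y; case: (f v) => i [].
- move=> v w vA wA vw; apply: pair_orth; last first.
  + by apply: contraTneq vw => /f_inj -> //; rewrite e_irr.
  + exact: f_adj.
  + by move=> i; rewrite /plane_frame dot_vec2; ring.
- move=> u v w uA vA _ uv _ _ /plane_frame_parallel /f_inj E _.
  by rewrite E ?eqxx in uv.
Qed.

End Plane.

(** * Generic frames in space *)

Section Space.
Variables (R : rcfType).

Lemma poly_avoid (s : seq {poly R}) : 0 \notin s ->
  exists t, {in s, forall p : {poly R}, p.[t] != 0}.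
Proof.
move=> s0; pose p := \prod_(q <- s) q.
have p0 : p != 0.
  rewrite /p prodf_seq_neq0; apply/allP => q qs.
  by apply: contraNneq s0 => <-.
pose ts : seq R := [seq i%:R | i <- iota 0 (size p)].
have : ~~ all (root p) ts.
  apply/negP => rts; have := max_poly_roots p0 rts.
  rewrite map_inj_uniq ?iota_uniq; last by move=> i j /eqP; rewrite eqr_nat => /eqP.
  by rewrite size_map size_iota ltnn => /(_ isT).
case/allPn => t _ pt; exists t => q qs; apply: contra pt => q0.
rewrite /root /p horner_prod (big_rem q) //=.
by rewrite mulf_eq0 q0.
Qed.

Definition vec3 (a b c : R) : 'rV[R]_3 := \row_(i < 3) nth 0 [:: a; b; c] i.

Lemma vec3P (x : 'rV[R]_3) : exists a b c, x = vec3 a b c.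
Proof.
exists (x 0 0), (x 0 1), (x 0 2%:R); apply/rowP; case=> [[|[|[|//]]] lt_i];
by rewrite mxE /=; congr (x 0 _); apply/val_inj.
Qed.

Lemma vec3_inj a b c a' b' c' :
  vec3 a b c = vec3 a' b' c' -> [/\ a = a', b = b' & c = c'].
Proof. by move=> /rowP E; split; [have := E 0|have := E 1|have := E 2%:R]; rewrite !mxE. Qed.

Lemma vec3_0 : vec3 0 0 0 = 0.
Proof. by apply/rowP; case=> [[|[|[|//]]] lt_i]; rewrite !mxE. Qed.

Lemma dot_vec3 a b c a' b' c' :
  dot (vec3 a b c) (vec3 a' b' c') = a * a' + b * b' + c * c'.
Proof. by rewrite /dot !big_ord_recl big_ord0 !mxE /= addr0 !addrA. Qed.

Definition cross (x y : 'rV[R]_3) : 'rV[R]_3 :=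
  vec3 (x 0 1 * y 0 2%:R - x 0 2%:R * y 0 1)
       (x 0 2%:R * y 0 0 - x 0 0 * y 0 2%:R)
       (x 0 0 * y 0 1 - x 0 1 * y 0 0).

Lemma cross_vec3 a b c a' b' c' : cross (vec3 a b c) (vec3 a' b' c') =
  vec3 (b * c' - c * b') (c * a' - a * c') (a * b' - b * a').
Proof. by rewrite /cross !mxE. Qed.

Definition det3 x y z := dot (cross x y) z.

Lemma det3C x y z : det3 y x z = - det3 x y z.
Proof.
have [a [b [c ->]]] := vec3P x; have [a' [b' [c' ->]]] := vec3P y.
have [a'' [b'' [c'' ->]]] := vec3P z.
rewrite /det3 !cross_vec3 !dot_vec3; ring.
Qed.

Lemma det3_rot x y z : det3 y z x = det3 x y z.
Proof.
have [a [b [c ->]]] := vec3P x; have [a' [b' [c' ->]]] := vec3P y.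
have [a'' [b'' [c'' ->]]] := vec3P z.
rewrite /det3 !cross_vec3 !dot_vec3; ring.
Qed.

Lemma cross_orthl x y : dot (cross x y) x = 0.
Proof.
have [a [b [c ->]]] := vec3P x; have [a' [b' [c' ->]]] := vec3P y.
rewrite !cross_vec3 !dot_vec3; ring.
Qed.

Lemma cross_orthr x y : dot (cross x y) y = 0.
Proof.
have [a [b [c ->]]] := vec3P x; have [a' [b' [c' ->]]] := vec3P y.
rewrite !cross_vec3 !dot_vec3; ring.
Qed.

Lemma crossZ c y : cross (c *: y) y = 0.
Proof. by rewrite /cross !mxE -vec3_0; congr vec3; ring. Qed.

(** The rows of the rotation matrix of the quaternion (x, y, z, w), up to its
squared norm, are mutually orthogonal and have quadratic entries.  With
(x, y, z, w) = (1, t, t^3, t^7) the ten products of two coordinates are distinct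
powers of t, so that the three entries of a row have disjoint supports, and the
scalar product of a row with a fixed nonzero vector is a nonzero polynomial in t.
Finitely many such polynomials have a common non-root. *)
Lemma generic_frame (N : seq 'rV[R]_3) : exists p q,
  dot p q = 0 /\ {in N, forall n, n != 0 ->
    [/\ dot p n != 0, dot q n != 0 & det3 p q n != 0]}.
Proof.
(* Coefficients in t of the scalar products of n with the three rows.  The third
   row is the cross product of the first two divided by norm. *)
pose P (n : 'rV[R]_3) := let: (a, b, c) := (n 0 0, n 0 1, n 0 2%:R) in
  Poly [:: a; 0; a; 2 * c; 2 * b; 0; - a; - 2 * b; 2 * c; 0; 0; 0; 0; 0; - a].
pose Q (n : 'rV[R]_3) := let: (a, b, c) := (n 0 0, n 0 1, n 0 2%:R) in
  Poly [:: b; - 2 * c; - b; 0; 2 * a; 0; b; 2 * a; 0; 0; 2 * c; 0; 0; 0; - b].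
pose S (n : 'rV[R]_3) := let: (a, b, c) := (n 0 0, n 0 1, n 0 2%:R) in
  Poly [:: c; 2 * b; - c; - 2 * a; 0; 0; - c; 0; 2 * a; 0; 2 * b; 0; 0; 0; c].
pose N' := [seq n <- N | n != 0].
have two_inj (a : R) : 2 * a = 0 -> a = 0 by lra.
have [|t tP] := @poly_avoid ([seq P n | n <- N'] ++ [seq Q n | n <- N'] ++
                           [seq S n | n <- N']).
  rewrite !mem_cat !negb_or; apply/and3P; split; apply/mapP => -[n];
    rewrite mem_filter => /andP[/eqP n0 _] /polyP E; apply: n0;
    have [a [b [c nE]]] := vec3P n; rewrite nE in E; rewrite nE -vec3_0.
  - have := E 0%N; have := E 4; have := E 8; rewrite !coef_Poly !coef0 !mxE /=.
    by move=> /esym/two_inj-> /esym/two_inj-> <-.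
  - have := E 0%N; have := E 4; have := E 10; rewrite !coef_Poly !coef0 !mxE /=.
    by move=> /esym/two_inj-> /esym/two_inj-> <-.
  - have := E 0%N; have := E 8; have := E 10; rewrite !coef_Poly !coef0 !mxE /=.
    by move=> /esym/two_inj-> /esym/two_inj-> <-.
pose norm := 1 + t ^+ 2 + t ^+ 6 + t ^+ 14.
have norm_neq0 : norm != 0.
  rewrite /norm gt_eqF // (_ : 6 = 3 * 2)%N // (_ : 14 = 7 * 2)%N // !(exprM t _ 2).
  by have := sqr_ge0 t; have := sqr_ge0 (t ^+ 3); have := sqr_ge0 (t ^+ 7); lra.
exists (vec3 (1 + t ^+ 2 - t ^+ 6 - t ^+ 14) (2 * (t ^+ 4 - t ^+ 7)) (2 * (t ^+ 8 + t ^+ 3))).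
exists (vec3 (2 * (t ^+ 4 + t ^+ 7)) (1 - t ^+ 2 + t ^+ 6 - t ^+ 14) (2 * (t ^+ 10 - t))).
split=> [|n nN n0]; first by rewrite dot_vec3; ring.
have nN' : n \in N' by rewrite mem_filter n0.
have memP : P n \in [seq P n | n <- N'] by apply: map_f.
have memQ : Q n \in [seq Q n | n <- N'] by apply: map_f.
have memS : S n \in [seq S n | n <- N'] by apply: map_f.
have := tP (P n); have := tP (Q n); have := tP (S n).
rewrite !mem_cat memP memQ memS !orbT.
move=> /(_ isT) Sn /(_ isT) Qn /(_ isT) Pn.
have [a [b [c nE]]] := vec3P n.
split.
- apply: contraNneq Pn; rewrite /P nE dot_vec3 horner_Poly !mxE /= => E; rewrite -[eqbRHS]E.
  by apply/eqP; ring.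
- apply: contraNneq Qn; rewrite /Q nE dot_vec3 horner_Poly !mxE /= => E; rewrite -[eqbRHS]E.
  by apply/eqP; ring.
- apply: contraNneq Sn => E; rewrite -(mulrI_eq0 _ (mulfI norm_neq0)) -E.
  rewrite /S nE /det3 cross_vec3 dot_vec3 horner_Poly !mxE /= /norm.
  by apply/eqP; ring.
Qed.

Lemma det3_cross0 (x y z : 'rV[R]_3) : cross x z = 0 -> det3 x y z = 0.
Proof. by move=> xz; rewrite -det3_rot -det3_rot det3C /det3 xz dot0l oppr0. Qed.

Lemma cross0l (y : 'rV[R]_3) : cross 0 y = 0.
Proof. by have := crossZ 0 y; rewrite scale0r. Qed.

Lemma other_end (x : nat * bool) : x != (x.1, ~~ x.2).
Proof. by case: x => i []; rewrite xpair_eqE andbF. Qed.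

(** The vectors are indexed by the ends of the edges of a matching: orthogonality
holds along the edges, and no other degeneracy occurs. *)
Definition generic_pairs (n : nat) (X : nat * bool -> 'rV[R]_3) :=
  [/\ forall i, dot (X (i, false)) (X (i, true)) = 0,
      forall x y, (x.1 < n)%N -> (y.1 < n)%N -> x.1 != y.1 -> dot (X x) (X y) != 0,
      forall x y, (x.1 < n)%N -> (y.1 < n)%N -> x != y -> cross (X x) (X y) != 0 &
      forall x y z, (x.1 < n)%N -> (y.1 < n)%N -> (z.1 < n)%N ->
        x != y -> x != z -> y != z -> det3 (X x) (X y) (X z) != 0].

Lemma generic_pairs_neq0 n X : generic_pairs n X ->
  forall x, (x.1 < n)%N -> X x != 0.
Proof.
move=> [_ _ Xcross _] x lt; have := Xcross x (x.1, ~~ x.2) lt lt (other_end x).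
by apply: contraNneq => ->; rewrite cross0l.
Qed.

(** Pairs are added one at a time.  The new pair is generic with respect to the
old vectors and to the normals of the planes that they span two by two. *)
Lemma generic_pairs_exist n : exists X, generic_pairs n X.
Proof.
elim: n => [|n [X genX]].
  by exists (fun=> 0); split=> // i; rewrite dot0l.
have [Xpair Xdot Xcross Xdet] := genX.
pose L := [seq (i, s) | i <- iota 0 n, s <- [:: false; true]].
have inL x : (x.1 < n)%N -> x \in L.
  case: x => i s /= lt; apply/allpairsP; exists (i, s) => /=.
  by rewrite mem_iota add0n lt; split=> //; case: s.
(* The vector (1, 0, 0) makes the new pair independent even when n = 0. *)
pose N := vec3 1 0 0 :: [seq X x | x <- L] ++ [seq cross (X x) (X y) | x <- L, y <- L].
have e0 : vec3 1 0 0 != 0 :> 'rV[R]_3.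
  by apply/eqP; rewrite -vec3_0 => /vec3_inj [] /eqP; rewrite oner_eq0.
have [p [q [pq Ngen]]] := generic_frame N.
pose X' x := if x.1 == n then if x.2 then q else p else X x.
have X'old x : (x.1 < n)%N -> X' x = X x.
  by rewrite /X' ltn_neqAle => /andP[/negbTE ->].
have case_lt x : (x.1 < n.+1)%N -> (x.1 < n)%N \/ x.1 = n.
  by rewrite ltnS leq_eqVlt => /orP[/eqP|]; [right|left].
have X_neq0 := generic_pairs_neq0 genX.
have newP x n' : x.1 = n -> n' \in N -> n' != 0 -> dot (X' x) n' != 0.
  by move=> xn n'N n'0; rewrite /X' xn eqxx; case: (x.2); have [] := Ngen _ n'N n'0.
have new2P x y n' : x.1 = n -> y.1 = n -> x != y -> n' \in N -> n' != 0 ->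
    det3 (X' x) (X' y) n' != 0.
  case: x y => [_ []] [_ []] /= -> ->; rewrite /X' /= ?eqxx // => _ n'N n'0.
    by rewrite det3C oppr_eq0; have [] := Ngen _ n'N n'0.
  by have [] := Ngen _ n'N n'0.
have XN x : (x.1 < n)%N -> X x \in N.
  by move=> lt; rewrite inE mem_cat map_f ?orbT ?inL.
have crossN x y : (x.1 < n)%N -> (y.1 < n)%N -> cross (X x) (X y) \in N.
  move=> ltx lty; rewrite inE mem_cat; apply/orP; right; apply/orP; right.
  by apply/allpairsP; exists (x, y); rewrite !inL.
have det1 x y z : x.1 = n -> (y.1 < n)%N -> (z.1 < n)%N -> y != z ->
    det3 (X' x) (X' y) (X' z) != 0.
  move=> xn ltx lty yz; rewrite -det3_rot /det3 dotC (X'old y) // (X'old z) // newP ?crossN //.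
  exact: Xcross.
have det2 x y z : x.1 = n -> y.1 = n -> (z.1 < n)%N -> x != y ->
    det3 (X' x) (X' y) (X' z) != 0.
  by move=> xn yn ltz xy; rewrite (X'old z) // new2P ?XN ?X_neq0.
have cross1 x y : x.1 = n -> (y.1 < n)%N -> cross (X' x) (X' y) != 0.
  move=> xn lty; have nx : (x.1, ~~ x.2).1 = n by [].
  have := other_end x.
  move/(det2 x (x.1, ~~ x.2) y xn nx lty); apply: contraNneq => /det3_cross0 ->.
  exact: eqxx.
exists X'; split.
- move=> i; rewrite /X' /=; case: eqP => // _; exact: pq.
- move=> x y /case_lt [ltx|xn] /case_lt [lty|yn] xy.
  + by rewrite !X'old ?Xdot.
  + by rewrite dotC (X'old x) // newP ?XN ?X_neq0.
  + by rewrite (X'old y) // newP ?XN ?X_neq0.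
  + by rewrite xn yn eqxx in xy.
- move=> x y /case_lt [ltx|xn] /case_lt [lty|yn] xy.
  + by rewrite !X'old ?Xcross.
  + apply: contraNneq (cross1 y x yn ltx) => E.
    have [a [b [c xE]]] := vec3P (X' x); have [a' [b' [c' yE]]] := vec3P (X' y).
    rewrite xE yE !cross_vec3 -vec3_0 in E *; have [E1 E2 E3] := vec3_inj E.
    by apply/eqP; congr vec3; lra.
  + exact: cross1.
  + have := new2P x y (vec3 1 0 0) xn yn xy (mem_head _ _) e0.
    by apply: contraNneq; rewrite /det3 => ->; rewrite dot0l.
- move=> x y z /case_lt [ltx|xn] /case_lt [lty|yn] /case_lt [ltz|zn] xy xz yz.
  + by rewrite !X'old ?Xdet.
  + by rewrite -det3_rot -det3_rot det1.
  + by rewrite -det3_rot det1 // eq_sym.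
  + by rewrite -det3_rot det2.
  + exact: det1.
  + by rewrite -det3_rot -det3_rot det2 // eq_sym.
  + exact: det2.
  + exfalso; move: x y z xn yn zn xy xz yz.
    by move=> [_ []] [_ []] [_ []] /= -> -> ->; rewrite ?eqxx.
Qed.

(** The case of maximum degree 2 in R^3, where vertices of the independent part
are cross products of generic vectors. *)
Lemma orthorep_space (T : finType) (e : rel T) (A : {set T}) :
  symmetric e -> irreflexive e -> {in A, forall v, deg_in e A v <= 2}%N ->
  orthorep R e 3 A.
Proof.
move=> e_sym e_irr degA.
have [B [sBA degB degC]] := @deg_partition _ _ e_sym e_irr A 1 0 degA.
have [f [f_inj f_lt f_adj]] := matching_index e_sym degB.
pose m := #|T|.
have [X genX] := generic_pairs_exist (m + m).
have [Xpair Xdot Xcross Xdet] := genX.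
have X0 := generic_pairs_neq0 genX.
pose rk (v : T) : nat := enum_rank v.
have rk_inj : injective rk by move=> v w /val_inj /enum_rank_inj.
have f_lt2 v : ((f v).1 < m + m)%N by have := f_lt v; rewrite -/m; lia.
(* Matching labels are below m; label m + rk u is reserved for the vectors that
   stand for missing neighbours of u. *)
pose nbrs u := [seq f w | w in [set w in B | e u w]].
pose dummies u := [:: ((m + rk u)%N, false); ((m + rk u)%N, true)].
pose L u := take 2 (nbrs u ++ dummies u).
have L_cases u x : x \in L u ->
    (exists w, [/\ w \in B, e u w & x = f w]) \/ x.1 = (m + rk u)%N.
  move/mem_take; rewrite mem_cat => /orP[/imageP[w]|].
    by rewrite inE => /andP[wB uw] ->; left; exists w.
  by rewrite !inE => /orP[] /eqP ->; right.
have L_lt u x : x \in L u -> (x.1 < m + m)%N.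
  case/L_cases => [[w [_ _ ->]]|->]; first exact: f_lt2.
  by rewrite ltn_add2l; apply: ltn_ord.
have L_size u : size (L u) = 2.
  by rewrite size_takel // size_cat [size (dummies u)]/= leq_addl.
have L_uniq u : uniq (L u).
  apply: take_uniq; rewrite cat_uniq; apply/and3P; split.
  - rewrite map_inj_in_uniq ?enum_uniq // => v w.
    by rewrite !mem_enum !inE => /andP[vB _] /andP[wB _]; apply: f_inj.
  - apply/hasPn => x xd; apply/negP => /imageP[w _ xw].
    have := f_lt w; rewrite -xw; move: xd.
    by rewrite !inE => /orP[] /eqP ->; rewrite /= -/m; lia.
  - by rewrite /= inE !xpair_eqE andbF.
have L_nbr u w : u \in A -> w \in B -> e u w -> f w \in L u.
  move=> uA wB uw; have fw : f w \in nbrs u by apply: image_f; rewrite inE wB.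
  have sz : (size (nbrs u) <= 2)%N.
    rewrite size_image; apply: leq_trans (degA u uA); apply: subset_leq_card.
    by apply/subsetP=> v; rewrite !inE => /andP[/(subsetP sBA) -> ->].
  by rewrite /L take_cat ltnNge sz mem_cat fw.
pose a u := nth (0%N, false) (L u) 0; pose b u := nth (0%N, false) (L u) 1.
have LE u : L u = [:: a u; b u].
  by rewrite /a /b; case: (L u) (L_size u) => [|x [|y []]].
have ab_neq u : a u != b u by have := L_uniq u; rewrite LE /= inE andbT.
have aL u : a u \in L u by rewrite LE !inE eqxx.
have bL u : b u \in L u by rewrite LE !inE eqxx orbT.
have aLt u := L_lt u _ (aL u); have bLt u := L_lt u _ (bL u).
pose Y v := if v \in B then X (f v) else cross (X (a v)) (X (b v)).
have crossL u x : x \in L u -> dot (cross (X (a u)) (X (b u))) (X x) = 0.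
  by rewrite LE !inE => /orP[] /eqP ->; rewrite ?cross_orthl ?cross_orthr.
have indep v w : v \in A -> w \in A -> v \notin B -> w \notin B -> ~~ e v w.
  move=> vA wA vB wB; have vC : v \in A :\: B by rewrite inE vB.
  apply/negP => vw; have := degC v vC; rewrite leqn0 cards_eq0 => /eqP /setP /(_ w).
  by rewrite !inE wB wA vw.
have Yfw u w : w \in B -> u \notin B -> u \in A -> e u w -> dot (Y u) (Y w) = 0.
  by move=> wB uB uA uw; rewrite /Y wB (negbTE uB) crossL ?L_nbr.
have Y0 v : v \in A -> Y v != 0.
  by move=> vA; rewrite /Y; case: ifP => _; [apply: X0 | apply: Xcross].
have par_sub v w : v \notin B -> w \notin B -> parallel (Y v) (Y w) ->
    {subset L w <= L v}.
  rewrite /Y => /negbTE -> /negbTE -> [c E] x xL; apply/negPn/negP => xNL.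
  have := Xdet (a v) (b v) x (aLt v) (bLt v) (L_lt _ _ xL) (ab_neq v).
  move: xNL; rewrite LE !inE negb_or ![x == _]eq_sym => /andP[-> ->] /(_ isT isT).
  by rewrite /det3 E dotZl crossL // mulr0 eqxx.
(* A generic vector on the line of w would be orthogonal to two others, while it
   is orthogonal only to the other end of its pair. *)
have par_B v w : v \in B -> w \notin B -> parallel (Y v) (Y w) -> False.
  rewrite /Y => -> /negbTE -> [c E].
  have orth x : x \in L w -> x.1 = (f v).1 /\ x != f v.
    move=> xL; have xv : dot (X (f v)) (X x) = 0 by rewrite E dotZl crossL // mulr0.
    split; last first.
      apply: contraTneq isT => xE; move: xv; rewrite xE => /eqP.
      by rewrite dot_eq0 (negbTE (X0 _ (f_lt2 v))).
    apply/eqP; rewrite eq_sym; apply: contraTT isT => /(Xdot _ _ (f_lt2 v) (L_lt _ _ xL)).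
    by rewrite xv eqxx.
  have [] := orth _ (aL w); have [] := orth _ (bL w); have := ab_neq w.
  case: (a w) (b w) (f v) => [i []] [j []] [k []] /= + jk + ik;
  by rewrite jk ik ?xpair_eqE ?eqxx ?andbF.
have par_sym v w : v \in A -> w \in A -> parallel (Y v) (Y w) -> parallel (Y w) (Y v).
  move=> vA wA [c E]; have c0 : c != 0.
    by apply: contraNneq (Y0 _ vA) => c0; rewrite E c0 scale0r.
  by exists c^-1; rewrite E scalerA mulVf // scale1r.
have par_neq v w : v \in A -> w \in A -> v != w -> parallel (Y v) (Y w) ->
    v \notin B /\ w \notin B.
  move=> vA wA vw par; have [vB|vB] := boolP (v \in B); have [wB|wB] // := boolP (w \in B).
  - exfalso; case: par; rewrite /Y vB wB => c E.
    have : cross (X (f v)) (X (f w)) != 0.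
      by apply: Xcross => //; apply: contra_neq vw; apply: f_inj.
    by rewrite E crossZ eqxx.
  - by case: (par_B v w).
  - by case: (par_B w v) => //; apply: par_sym.
apply: (orthorep_lines (Y := Y)) => //.
- move=> v w vA wA vw; have [vB|vB] := boolP (v \in B); have [wB|wB] := boolP (w \in B).
  + rewrite /Y vB wB; apply: pair_orth => //; first exact: f_adj.
    by apply: contraTneq vw => /f_inj -> //; rewrite e_irr.
  + by rewrite dotC Yfw // e_sym.
  + exact: Yfw.
  + by case/negP: (indep v w vA wA vB wB).
- move=> u v w uA vA wA uv uw vw par_uv par_uw.
  have [uB vB] := par_neq u v uA vA uv par_uv.
  have [_ wB] := par_neq u w uA wA uw par_uw.
  have auv : a u \in L v by apply: (par_sub v u) (aL u) => //; apply: par_sym.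
  have auw : a u \in L w by apply: (par_sub w u) (aL u) => //; apply: par_sym.
  (* A label in two of the lists is not reserved for a single vertex, hence it
     belongs to an actual neighbour, which then has u, v and w as neighbours. *)
  have real y z : y != z -> a u \in L y -> a u \in L z ->
      exists x, [/\ x \in B, e y x & a u = f x].
    move=> yz /L_cases [//|Ey] /L_cases [[x [_ _ Ez]]|Ez].
      by have := f_lt x; rewrite -Ez Ey -/m; lia.
    by case/eqP: yz; apply: rk_inj; lia.
  have [x [xB ux ax]] := real u v uv (aL u) auv.
  have [x' [x'B vx ax']] := real v w vw auv auw.
  have [x'' [x''B wx ax'']] := real w u (ltac:(by rewrite eq_sym)) auw (aL u).
  have ? : x' = x by apply: f_inj => //; rewrite -ax -ax'.
  have ? : x'' = x by apply: f_inj => //; rewrite -ax -ax''.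
  subst x' x''.
  have := degA x (subsetP sBA _ xB); rewrite leqNgt => /negP; apply.
  have c3 : #|[set w; u; v]| = 3.
    by rewrite -setUA cardsU1 cards2 !inE negb_or ![w == _]eq_sym uv uw vw.
  apply: (@leq_trans #|[set w; u; v]|); first by rewrite c3.
  apply: subset_leq_card; apply/subsetP=> y; rewrite !inE.
  by case/orP=> [/orP[]|] /eqP ->; rewrite ?uA ?vA ?wA /= e_sym.
Qed.

End Space.

(** * The main bound *)

(** A part of internal degree at most 1 is split off into a plane, and the rest,
of degree at most d - 3, is represented in the remaining d - 2 dimensions. *)
Lemma orthorep_exists (R : rcfType) (T : finType) (e : rel T) d :
  symmetric e -> irreflexive e -> (2 <= d)%N ->
  forall A : {set T}, {in A, forall v, deg_in e A v < d}%N -> orthorep R e d A.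
Proof.
move=> e_sym e_irr; elim/ltn_ind: d => -[|[|[|[|d]]]] // IH _ A degA.
- exact: orthorep_matching.
- exact: orthorep_space.
- have [|B [sBA degB degC]] := @deg_partition _ _ e_sym e_irr A 1 d.+1.
    by move=> v vA; have := degA v vA; rewrite addn1 add1n ltnS.
  rewrite -(addn2 d.+2) addnC; apply: (orthorepD sBA).
    exact: orthorep_matching.
  by apply: IH => //; rewrite leqnSn.
Qed.

Lemma orthorep_realizable (R : realType) (G : sgraph) d :
  orthorep R (@adj G) d [set: G] -> realizable (@sphere R d) G.
Proof.
case=> phi [phi_inj phi1 phi_orth].
pose c : R := (Num.sqrt 2)^-1.
have c2 : c ^+ 2 = 2^-1 by rewrite exprVn sqr_sqrtr.
have c0 : c != 0 by rewrite invr_eq0 sqrtr_eq0 -ltNge.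
exists (fun v => c *: phi v); split.
- by move=> v w /(scalerI c0) /phi_inj; apply; rewrite inE.
- move=> v; rewrite /sphere /edist /=.
  under eq_bigr => i _ do rewrite !mxE subr0 exprMn.
  rewrite -mulr_sumr; under eq_bigr => i _ do rewrite expr2.
  by rewrite -/(dot _ _) phi1 ?inE // mulr1 sqrtr_sqr ger0_norm ?div1r // invr_ge0 sqrtr_ge0.
- move=> v w vw; rewrite /edist.
  have -> : \sum_(i < d) ((c *: phi v) 0 i - (c *: phi w) 0 i) ^+ 2 =
            c ^+ 2 * (dot (phi v) (phi v) + dot (phi w) (phi w) - 2 * dot (phi v) (phi w)).
    rewrite /dot mulr_sumr -sumrN -!big_split mulr_sumr /=.
    by apply: eq_bigr => i _; rewrite !mxE; ring.
  rewrite !phi1 ?inE // phi_orth ?inE // mulr0 subr0 c2.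
  by rewrite -[1 + 1]/2%:R mulVf ?pnatr_eq0 // sqrtr1.
Qed.

Theorem proposition2 (R : realType) (d : nat) (hd : (2 <= d)%N) (G : sgraph)
    (hG : max_degree G = (d - 1)%N) : (spherical_dim R G <= d)%N.
Proof.
rewrite /spherical_dim; case: ex_minnP => k _; apply.
rewrite (ltn_trans _ hd) //=; apply/asboolP/orthorep_realizable.
apply: (orthorep_exists _ (@adj_sym G) (@adj_irrefl G) hd) => v _.
have : (degree v <= d - 1)%N by rewrite -hG /max_degree (bigD1 v) //= leq_maxl.
have -> : deg_in (@adj G) [set: G] v = degree v by apply: eq_card => w; rewrite !inE.
by move: hd; lia.
Qed.
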